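(* Let $n\ge2$, let $X_1,\dots,X_n$ be infinite dimensional Hilbert spaces and $D_k\in\mathcal{B}(X_k)$. Then for every $A\in\mathcal{B}_n$, $$\bigcup_{k=1}^n\sigma_l(D_k)=\sigma_l(T_n^d(A))\cup\Delta,\qquad \Delta=\bigcup_{k=2}^{n}\Big\{\lambda\in\sigma_l(D_k):\ \alpha(D_k-\lambda)\le\sum_{s=1}^{k-1}\beta(D_s-\lambda)\Big\}.$$ In particular, if $\Delta=\emptyset$ then $\bigcup_{k=1}^n\sigma_l(D_k)=\sigma_l(T_n^d(A))$ for every $A\in\mathcal{B}_n$.
   Context: For a bounded operator $T$, $\alpha(T)=\dim\mathcal{N}(T)$, $\beta(T)=\operatorname{codim}\mathcal{R}(T)$, values in $\{0,1,\dots\}\cup\{\infty\}$, sums and comparisons taken in this extended set. $T$ is left invertible if $\alpha(T)=0$ and $\mathcal{R}(T)$ is closed and complemented; $\sigma_l(T)=\{\lambda\in\mathbb{C}:\lambda-T$ not left invertible$\}$. $\mathcal{B}_n$ is the set of tuples $A=(A_{ij})_{1\le i<j\le n}$, $A_{ij}\in\mathcal{B}(X_j,X_i)$; $T_n^d(A)$ is the upper triangular operator matrix on $X_1\oplus\cdots\oplus X_n$ with diagonal $D_1,\dots,D_n$, entries $A_{ij}$ above the diagonal and zeros below. *)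

(* Defs.v *)
From HB Require Import structures.
From mathcomp Require Import all_boot all_order all_algebra.
From mathcomp Require Import boolp classical_sets reals.
From mathcomp Require Import complex.

Set Implicit Arguments.
Unset Strict Implicit.
Unset Printing Implicit Defensive.
Import Order.TTheory GRing.Theory Num.Theory.
Local Open Scope ring_scope.
Local Open Scope classical_set_scope.

Section OperatorDefs.
Variable R : realType.
Local Notation C := (R[i]).

(* ---------- extended naturals {0,1,...} ∪ {∞} (None = ∞) ---------- *)
Definition enat := option nat.
Definition enat_add (a b : enat) : enat :=
  match a, b with Some x, Some y => Some (x + y)%N | _, _ => None end.
Definition enat_le (a b : enat) : Prop :=
  match a, b with
  | _, None => True
  | None, Some _ => False
  | Some x, Some y => (x <= y)%N
  end.

(* The (extended) supremum of the nat-valued "dimension witnesses":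
   P k = "there are k independent vectors"; the value is the max such k
   if it exists, otherwise ∞. *)
Definition edim_of (P : nat -> Prop) : enat :=
  if `[< exists m, forall k, P k -> (k <= m)%N >]
  then Some (xget 0%N [set m | P m /\ forall k, P k -> (k <= m)%N])
  else None.

(* ---------- a complex vector space carrier with a norm (operations only) *)
Record nvs := NVS {
  vcar : Type;
  vzero : vcar;
  vadd : vcar -> vcar -> vcar;
  vscale : C -> vcar -> vcar;
  vnorm : vcar -> R }.

Section NVS.
Variable V : nvs.
Definition vsub (x y : vcar V) := vadd x (vscale (-1) y).
Definition lcomb (k : nat) (c : 'I_k -> C) (v : 'I_k -> vcar V) : vcar V :=
  \big[@vadd V/vzero V]_(i < k) vscale (c i) (v i).
Definition indep_in (S : set (vcar V)) (k : nat) : Prop :=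
  exists v : 'I_k -> vcar V, (forall i, S (v i)) /\
    forall c : 'I_k -> C, lcomb c v = vzero V -> forall i, c i = 0.
Definition indep_mod (W : set (vcar V)) (k : nat) : Prop :=
  exists v : 'I_k -> vcar V,
    forall c : 'I_k -> C, W (lcomb c v) -> forall i, c i = 0.
Definition edim (S : set (vcar V)) : enat := edim_of (indep_in S).
Definition ecodim (W : set (vcar V)) : enat := edim_of (indep_mod W).

Definition converges (u : nat -> vcar V) (x : vcar V) : Prop :=
  forall e : R, 0 < e -> exists N, forall m, (N <= m)%N -> vnorm (vsub (u m) x) < e.
Definition closed_set (S : set (vcar V)) : Prop :=
  forall (u : nat -> vcar V) x, (forall m, S (u m)) -> converges u x -> S x.
Definition subspace (S : set (vcar V)) : Prop :=
  S (vzero V) /\ (forall x y, S x -> S y -> S (vadd x y)) /\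
  (forall a x, S x -> S (vscale a x)).
Definition complemented (S : set (vcar V)) : Prop :=
  exists M : set (vcar V), subspace M /\ closed_set M /\
    (forall x, S x -> M x -> x = vzero V) /\
    (forall x, exists y z, S y /\ M z /\ x = vadd y z).
End NVS.

Section Ops.
Variables U W : nvs.
Definition kernel (T : vcar U -> vcar W) : set (vcar U) := [set x | T x = vzero W].
Definition range (T : vcar U -> vcar W) : set (vcar W) := [set y | exists x, T x = y].
Definition alpha (T : vcar U -> vcar W) : enat := edim (kernel T).
Definition beta (T : vcar U -> vcar W) : enat := ecodim (range T).
Definition left_invertible (T : vcar U -> vcar W) : Prop :=
  alpha T = Some 0%N /\ closed_set (range T) /\ complemented (range T).
End Ops.

Definition op_sub_scal (V : nvs) (T : vcar V -> vcar V) (l : C) : vcar V -> vcar V :=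
  fun x => vsub (T x) (vscale l x).
Definition scal_sub_op (V : nvs) (l : C) (T : vcar V -> vcar V) : vcar V -> vcar V :=
  fun x => vsub (vscale l x) (T x).
Definition sigma_l (V : nvs) (T : vcar V -> vcar V) : set C :=
  [set l | ~ left_invertible (scal_sub_op l T)].

Section Hilbert.
Variable V : lmodType C.
Variable ip : V -> V -> C.
Definition hnorm (x : V) : R := Num.sqrt (complex.Re (ip x x)).
Definition is_hilbert : Prop :=
  (forall (a : C) (x y z : V), ip (a *: x + y) z = a * ip x z + ip y z) /\
  (forall x y, ip y x = conjc (ip x y)) /\
  (forall x, 0 <= complex.Re (ip x x)) /\
  (forall x, ip x x = 0 -> x = 0) /\
  (forall u : nat -> V,
     (forall e : R, 0 < e -> exists N, forall m p, (N <= m)%N -> (N <= p)%N ->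
        hnorm (u m - u p) < e) ->
     exists x, forall e : R, 0 < e -> exists N, forall m, (N <= m)%N ->
        hnorm (u m - x) < e).
Definition nvs_of : nvs := @NVS V 0 +%R *:%R hnorm.
Definition infinite_dim : Prop := forall k, indep_in (V := nvs_of) setT k.
End Hilbert.

Definition bounded_op (U W : lmodType C) (ipU : U -> U -> C) (ipW : W -> W -> C)
  (T : U -> W) : Prop :=
  (forall (a : C) x y, T (a *: x + y) = a *: T x + T y) /\
  exists M : R, forall x, hnorm ipW (T x) <= M * hnorm ipU x.

Section DSum.
Variable n : nat.
Variable X : 'I_n -> lmodType C.
Variable ip : forall k, X k -> X k -> C.
Definition dsum : nvs :=
  @NVS (forall k, X k) (fun k => 0) (fun x y k => x k + y k)
       (fun a x k => a *: x k)
       (fun x => Num.sqrt (\sum_(k < n) hnorm (@ip k) (x k) ^+ 2)).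

Definition Tmat (D : forall k, X k -> X k) (A : forall i j : 'I_n, X j -> X i)
  : vcar dsum -> vcar dsum :=
  fun x i => D i (x i) + \sum_(j < n | (i < j)%N) A i j (x j).

(* Δ = ⋃_{k=2}^n {λ ∈ σ_l(D_k) : α(D_k-λ) ≤ Σ_{s=1}^{k-1} β(D_s-λ)}
   (indices are 0-based here: k ranges over 1..n-1, s over 0..k-1) *)
Definition Delta (D : forall k, X k -> X k) : set C :=
  [set l | exists k : 'I_n, (0 < k)%N /\ sigma_l (V := nvs_of (@ip k)) (D k) l /\
     enat_le (alpha (op_sub_scal (V := nvs_of (@ip k)) (D k) l))
             (\big[enat_add/Some 0%N]_(s < n | (s < k)%N)
                 beta (op_sub_scal (V := nvs_of (@ip s)) (D s) l))].
End DSum.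

End OperatorDefs.

(* Main.v *)
Require Import Defs.
From HB Require Import structures.
From mathcomp Require Import all_boot all_order all_algebra.
From mathcomp Require Import boolp classical_sets reals.
From mathcomp Require Import complex.
From mathcomp Require Import ring lra.

(* On Hilbert spaces a bounded operator is left invertible iff it is bounded below (open
   mapping theorem and orthogonal projection).  After replacing D by lambda - D: if every
   D_k is bounded below, then so is T, by back substitution; and if T is bounded below, then
   so is D_1, the restriction of T to X_1.  If T is injective and k >= 2, then
   alpha(D_k) <= sum_(s < k) beta(D_s): the restriction of T to X_1 + ... + X_(k-1) has range
   of codimension at most this sum, so otherwise the column A_(.,k) would send some nonzero
   vector of N(D_k) into that range, which yields a nonzero vector in N(T). *)

Set Implicit Arguments.
Unset Strict Implicit.
Unset Printing Implicit Defensive.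
Import Order.TTheory GRing.Theory Num.Theory.
Local Open Scope ring_scope.
Local Open Scope classical_set_scope.
Local Open Scope complex_scope.

(** * Inner product spaces *)

Section InnerProduct.
Variables (R : realType) (V : lmodType R[i]) (ip : V -> V -> R[i]).
Hypothesis ipH : is_hilbert ip.
Local Notation nm := (hnorm ip).

(** The real part is a real inner product with the same norm, so Cauchy-Schwarz and orthogonality
    can be handled over the ordered field [R]. *)
Definition rip (x y : V) : R := complex.Re (ip x y).

Lemma ipDl x y z : ip (x + y) z = ip x z + ip y z.
Proof. by case: ipH => + _ => /(_ 1 x y z); rewrite scale1r mul1r. Qed.

Lemma ip0l z : ip 0 z = 0.
Proof. by have := ipDl 0 0 z; rewrite addr0 => /eqP; rewrite -subr_eq0 opprD addNKr oppr_eq0 => /eqP. Qed.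

Lemma ipZl a x z : ip (a *: x) z = a * ip x z.
Proof. by case: ipH => + _ => /(_ a x 0 z); rewrite addr0 ip0l addr0. Qed.

Lemma ip_conj x y : ip y x = conjc (ip x y).
Proof. by case: ipH => _ [] ->. Qed.

Lemma ipZr a x z : ip z (a *: x) = conjc a * ip z x.
Proof. by rewrite ip_conj ipZl [in RHS](ip_conj x) rmorphM. Qed.

Lemma ripDl x y z : rip (x + y) z = rip x z + rip y z.
Proof. by rewrite /rip ipDl raddfD. Qed.

Lemma ripC x y : rip x y = rip y x.
Proof. by rewrite /rip (ip_conj y x); case: (ip y x). Qed.

Lemma ripDr x y z : rip z (x + y) = rip z x + rip z y.
Proof. by rewrite ripC ripDl !(ripC z). Qed.

Lemma ripZl (r : R) x y : rip (r%:C *: x) y = r * rip x y.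
Proof. by rewrite /rip ipZl; case: (ip x y) => a b /=; rewrite mul0r subr0. Qed.

Lemma ripZr (r : R) x y : rip x (r%:C *: y) = r * rip x y.
Proof. by rewrite ripC ripZl ripC. Qed.

Lemma ripNl x y : rip (- x) y = - rip x y.
Proof.
by rewrite -scaleN1r -(rmorphN1 (real_complex R)) ripZl mulN1r.
Qed.

Lemma ripNr x y : rip x (- y) = - rip x y.
Proof. by rewrite ripC ripNl ripC. Qed.

Lemma rip_ge0 x : 0 <= rip x x.
Proof. by case: ipH => _ [_ [h _]]; apply: h. Qed.

(** Conjugate symmetry makes [ip x x] real, so it vanishes as soon as its real part does. *)
Lemma rip_eq0 x : rip x x = 0 -> x = 0.
Proof.
case: ipH => _ [_ [_ [h _]]] e; apply: h; have := ip_conj x x.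
move: e; rewrite /rip; case: (ip x x) => a b /= -> /= [] hb.
by rewrite (_ : b = 0)//; lra.
Qed.

Lemma hnorm_sqr x : nm x ^+ 2 = rip x x.
Proof. by rewrite sqr_sqrtr ?rip_ge0. Qed.

Lemma hnorm_ge0 x : 0 <= nm x. Proof. exact: sqrtr_ge0. Qed.

Lemma hnorm0 : nm 0 = 0.
Proof. by rewrite /hnorm ip0l sqrtr0. Qed.

Lemma hnorm0_eq0 x : nm x = 0 -> x = 0.
Proof. by move=> h; apply: rip_eq0; rewrite -hnorm_sqr h expr0n. Qed.

Lemma hnorm_scale (r : R) x : nm (r%:C *: x) = `|r| * nm x.
Proof.
apply/eqP; rewrite -(eqrXn2 (n:=2)) ?mulr_ge0 ?hnorm_ge0//.
by rewrite exprMn !hnorm_sqr ripZl ripZr mulrA -expr2 real_normK// num_real.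
Qed.

Lemma hnorm_scaleC (a : R[i]) x :
  nm (a *: x) = Num.sqrt (complex.Re a ^+ 2 + complex.Im a ^+ 2) * nm x.
Proof.
apply/eqP; rewrite -(eqrXn2 (n:=2)) ?mulr_ge0 ?sqrtr_ge0 ?hnorm_ge0//.
rewrite exprMn !hnorm_sqr sqr_sqrtr ?addr_ge0 ?sqr_ge0// /rip ipZl ipZr.
by case: a (ip x x) => p q [r s] /=; apply/eqP; ring.
Qed.

Lemma hnorm_opp x : nm (- x) = nm x.
Proof. by rewrite -scaleN1r -(rmorphN1 (real_complex R)) hnorm_scale normrN1 mul1r. Qed.

Lemma hnorm_subC x y : nm (x - y) = nm (y - x).
Proof. by rewrite -hnorm_opp opprB. Qed.

Lemma hnorm_add_sqr x y : nm (x + y) ^+ 2 = nm x ^+ 2 + 2 * rip x y + nm y ^+ 2.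
Proof. by rewrite !hnorm_sqr !ripDl !ripDr (ripC y x); ring. Qed.

Lemma hnorm_sub_sqr x y : nm (x - y) ^+ 2 = nm x ^+ 2 - 2 * rip x y + nm y ^+ 2.
Proof. by rewrite hnorm_add_sqr hnorm_opp ripNr; ring. Qed.

Lemma cauchy_schwarz x y : rip x y <= nm x * nm y.
Proof.
have [x0|x0] := eqVneq (nm x) 0.
  by rewrite x0 (hnorm0_eq0 x0) /rip ip0l mul0r.
have [y0|y0] := eqVneq (nm y) 0.
  by rewrite y0 (hnorm0_eq0 y0) ripC /rip ip0l mulr0.
have gt0 : 0 < nm x * nm y by rewrite mulr_gt0// lt0r ?x0 ?y0 hnorm_ge0.
(* With $a=\|x\|$, $b=\|y\|$, the square $\|bx-ay\|^2$ expands to $2ab(ab-\mathrm{rip}(x,y))$, and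
   $ab>0$ can be cancelled. *)
have := sqr_ge0 (nm ((nm y)%:C *: x - (nm x)%:C *: y)).
rewrite hnorm_sub_sqr !hnorm_scale ripZl ripZr !ger0_norm ?hnorm_ge0//.
by move=> h; rewrite -(ler_pM2l gt0); nra.
Qed.

Lemma hnorm_le_add x y : nm (x + y) <= nm x + nm y.
Proof.
rewrite -(ler_pXn2r (n := 2)) ?nnegrE ?addr_ge0 ?hnorm_ge0//.
by rewrite hnorm_add_sqr; have := cauchy_schwarz x y; nra.
Qed.

Lemma hnorm_triangle x y z : nm (x - z) <= nm (x - y) + nm (y - z).
Proof. by rewrite (_ : x - z = (x - y) + (y - z)) ?hnorm_le_add// addrA subrK. Qed.

Lemma hnorm_sum (I : finType) (P : pred I) (f : I -> V) :
  nm (\sum_(i | P i) f i) <= \sum_(i | P i) nm (f i).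
Proof.
elim/big_rec2 : _ => [|i y x _ h]; first by rewrite hnorm0.
by rewrite (le_trans (hnorm_le_add _ _))// lerD2l.
Qed.

Lemma vsub_nvs_of (x y : V) : vsub (V := nvs_of ip) x y = x - y.
Proof. by rewrite /vsub /= scaleN1r. Qed.

Lemma converges_nvs_of (u : nat -> V) (x : V) : converges (V := nvs_of ip) u x <->
  forall e : R, 0 < e -> exists N, forall m, (N <= m)%N -> nm (u m - x) < e.
Proof.
by split=> h e /h[N hN]; exists N => m /hN; rewrite vsub_nvs_of.
Qed.

Lemma converges_unique (u : nat -> V) x y :
  converges (V := nvs_of ip) u x -> converges (V := nvs_of ip) u y -> x = y.
Proof.
move=> /converges_nvs_of hx /converges_nvs_of hy; apply/eqP; rewrite -subr_eq0; apply/eqP/hnorm0_eq0.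
apply/eqP; rewrite eq_le hnorm_ge0 andbT leNgt; apply/negP => gt0.
have e0 : 0 < nm (x - y) / 2 by rewrite divr_gt0.
have [N1 h1] := hx _ e0; have [N2 h2] := hy _ e0.
have := h1 _ (leq_maxl N1 N2); have := h2 _ (leq_maxr N1 N2).
set m := maxn _ _ => h3 h4; have := hnorm_triangle x (u m) y.
by rewrite (hnorm_subC x (u m)); lra.
Qed.

(** Choose $N>|K|/e$ by the Archimedean property; then $m<2^m$ suffices. *)
Lemma half_power_small (K e : R) : 0 < e -> exists N, forall m, (N <= m)%N -> K * 2^-1 ^+ m < e.
Proof.
move=> e0; have [N hN] : exists N : nat, `|K| / e < N%:R.
  by exists (Num.bound (`|K| / e)); rewrite archi_boundP// divr_ge0// ltW.
exists N => m Nm; apply: (@le_lt_trans _ _ (`|K| * 2^-1 ^+ m)).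
  by rewrite ler_wpM2r ?ler_norm ?exprn_ge0 ?invr_ge0.
rewrite exprVn ltr_pdivrMr ?exprn_gt0// mulrC -ltr_pdivrMr// (lt_le_trans hN)//.
by rewrite -natrX ler_nat (leq_trans Nm)// ltnW// ltn_expl.
Qed.

(** Peeling off the first step leaves $Kq^j+2Kq^{j+1}\le 2Kq^j$, which is where $q\le 1/2$
    enters. *)
Lemma geometric_tail (s : nat -> V) (K q : R) : 0 <= K -> 0 <= q <= 2^-1 ->
  (forall j, nm (s j.+1 - s j) <= K * q ^+ j) ->
  forall i j, nm (s (j + i)%N - s j) <= 2 * K * q ^+ j.
Proof.
move=> K0 /andP[q0 q2] hs; elim=> [|i IH] j.
  by rewrite addn0 subrr hnorm0 !mulr_ge0// exprn_ge0.
rewrite -addSnnS (le_trans (hnorm_triangle _ (s j.+1) _))//.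
have h1 := IH j.+1; have h2 := hs j; rewrite exprS in h1.
have h3 : 0 <= K * q ^+ j by rewrite mulr_ge0// exprn_ge0.
rewrite (le_trans (lerD h1 h2))//; nra.
Qed.

(** Completeness enters the gliding hump, the successive approximation and the projection in this
    form; the explicit error bound is the limit of the tail bound. *)
Lemma geometric_converges (s : nat -> V) (K q : R) : 0 <= K -> 0 <= q <= 2^-1 ->
  (forall j, nm (s j.+1 - s j) <= K * q ^+ j) ->
  exists2 x, converges (V := nvs_of ip) s x & forall j, nm (x - s j) <= 2 * K * q ^+ j.
Proof.
move=> K0 q02 hs; have tail := geometric_tail K0 q02 hs.
have tail2 j m : (j <= m)%N -> nm (s m - s j) <= 2 * K * q ^+ j.
  by move=> jm; rewrite -(subnKC jm) tail.
have /andP[q0 q2] := q02.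
have [x hx] : exists x, forall e : R, 0 < e -> exists N, forall m, (N <= m)%N -> nm (s m - x) < e.
  case: ipH => _ [_ [_ [_]]]; apply=> e e0.
  have [N hN] := half_power_small (2 * (2 * K)) e0.
  exists N => m p Nm Np; have := hnorm_triangle (s m) (s N) (s p).
  rewrite (hnorm_subC (s N)); have := tail2 _ _ Nm; have := tail2 _ _ Np; have := hN N (leqnn N).
  have : 2 * K * q ^+ N <= 2 * K * 2^-1 ^+ N.
    by rewrite ler_wpM2l ?mulr_ge0// lerXn2r ?nnegrE ?invr_ge0.
  lra.
exists x; first exact/converges_nvs_of.
move=> j; apply/ler_addgt0Pr => e /hx[N hN].
have := hN _ (leq_maxl N j); have := tail2 _ _ (leq_maxr N j).
have := hnorm_triangle x (s (maxn N j)) (s j); rewrite (hnorm_subC x (s (maxn N j))); lra.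
Qed.

End InnerProduct.

(** * Open mapping theorem *)

(** [P 0] makes the bounded set of witnesses nonempty, so a maximum exists and the default value of
    [xget] is never returned. *)
Lemma edim_of_Some (P : nat -> Prop) a : P 0%N -> edim_of P = Some a ->
  P a /\ forall k, P k -> (k <= a)%N.
Proof.
move=> P0; rewrite /edim_of; case: asboolP => // -[m hm] [<-].
case: xgetP => [_ _ []//|] no_max; exfalso.
have exP : exists k, `[< P k >] by exists 0%N; apply/asboolP.
have hmb k : `[< P k >] -> (k <= m)%N by move/asboolP; exact: hm.
case: (ex_maxnP exP hmb) => i /asboolP Pi hi; apply: (no_max i).
by split=> // k Pk; apply: hi; apply/asboolP.
Qed.

Lemma edim_of_None (P : nat -> Prop) : edim_of P = None ->
  forall m, exists2 k, P k & (m < k)%N.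
Proof.
rewrite /edim_of; case: asboolP => // /forallNP h _ m.
by have /existsNP[k /not_implyP[Pk /negP]] := h m; rewrite -ltnNge; exists k.
Qed.

Section Operators.
Variables (R : realType) (V W : lmodType R[i]).
Variables (ipV : V -> V -> R[i]) (ipW : W -> W -> R[i]).
Hypotheses (ipVH : is_hilbert ipV) (ipWH : is_hilbert ipW).
Variable T : V -> W.
Hypothesis Tb : bounded_op ipV ipW T.
Local Notation nV := (hnorm ipV).
Local Notation nW := (hnorm ipW).
Local Notation rangeT := (Defs.range (U := nvs_of ipV) (W := nvs_of ipW) T).

Definition bounded_below := exists2 c : R, 0 < c & forall x, c * nV x <= nW (T x).

Lemma bounded_opD x y : T (x + y) = T x + T y.
Proof. by case: Tb => + _ => /(_ 1 x y); rewrite !scale1r. Qed.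

Lemma bounded_op0 : T 0 = 0.
Proof. by apply: (addIr (T 0)); rewrite -bounded_opD !add0r. Qed.

Lemma bounded_opZ a x : T (a *: x) = a *: T x.
Proof. by case: Tb => + _ => /(_ a x 0); rewrite bounded_op0 !addr0. Qed.

Lemma bounded_opN x : T (- x) = - T x.
Proof. by rewrite -scaleN1r bounded_opZ scaleN1r. Qed.

Lemma bounded_opB x y : T (x - y) = T x - T y.
Proof. by rewrite bounded_opD bounded_opN. Qed.

Lemma bounded_op_bound : exists2 M : R, 0 < M & forall x, nW (T x) <= M * nV x.
Proof.
case: Tb => _ [M hM]; exists (`|M| + 1) => [|x]; first by rewrite ltr_wpDl.
rewrite (le_trans (hM x))// ler_wpM2r ?hnorm_ge0//.
by have := ler_norm M; lra.
Qed.

Lemma alpha_eq0 : alpha (U := nvs_of ipV) (W := nvs_of ipW) T = Some 0%N <->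
  forall x, T x = 0 -> x = 0.
Proof.
have P0 : indep_in (V := nvs_of ipV) (kernel (U := nvs_of ipV) (W := nvs_of ipW) T) 0.
  by exists (fun _ => 0 : V); split=> [[]//|c _ []//].
split=> [/(edim_of_Some P0)[_ h] x Tx|h].
  apply: contrapT => x0; suff /h : indep_in (V := nvs_of ipV)
    (kernel (U := nvs_of ipV) (W := nvs_of ipW) T) 1 by [].
  exists (fun _ => x); split=> // c; rewrite /lcomb big_ord1 /= => cx i.
  rewrite ord1; apply: contrapT => /eqP c0; apply: x0.
  by rewrite -[x]scale1r -(mulVf c0) -scalerA cx scaler0.
have noP k : indep_in (V := nvs_of ipV) (kernel (U := nvs_of ipV) (W := nvs_of ipW) T) k ->
    k = 0%N.
  (* All vectors of the kernel are zero, so the combination with every coefficient 1 vanishes, which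
     refutes independence. *)
  case: k => // k [v [kv /(_ (fun=> 1))]]; rewrite /lcomb big1 => [|i _].
    by move=> /(_ erefl ord0) /eqP; rewrite oner_eq0.
  by rewrite (h (v i) (kv i)) /= scaler0.
rewrite /alpha /edim; case e: edim_of => [a|].
  by have [/noP ->] := edim_of_Some P0 e.
by have [k /noP ->] := edim_of_None e 0.
Qed.

Lemma bounded_op_converges (u : nat -> V) x :
  converges (V := nvs_of ipV) u x -> converges (V := nvs_of ipW) (T \o u) (T x).
Proof.
move=> /converges_nvs_of h; apply/converges_nvs_of => e e0.
have [M M0 hM] := bounded_op_bound.
have [N hN] := h _ (divr_gt0 e0 M0); exists N => m /hN.
by rewrite ltr_pdivlMr// mulrC -bounded_opB => /(le_lt_trans (hM _)).
Qed.

(* A gliding hump replaces Baire's theorem: if the claim fails, the partial sums of a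
   rapidly decaying series can be kept away from the image of every ball. *)
Lemma closed_range_approx : closed_set rangeT ->
  exists C : nat, forall y, rangeT y ->
    exists2 x, nV x <= C%:R * nW y & nW (y - T x) <= 2^-1 * nW y.
Proof.
move=> clT; apply: contrapT => /forallNP bad.
pose q : R := 16^-1.
have q_gt0 j : 0 < q ^+ j by rewrite exprn_gt0// invr_gt0.
have hump j : exists y, [/\ rangeT y, nW y = q ^+ j &
    forall x, nV x <= (2 * j)%:R -> q ^+ j / 2 < nW (y - T x)].
  (* The constant $2j\,16^j$ is chosen so that scaling [y] to norm $16^{-j}$ turns the ball of
     radius $2j\,16^j\|y\|$ into the ball of radius $2j$. *)
  have /existsNP[y /not_implyP[[z Tz] /forall2NP hy]] := bad (2 * j * 16 ^ j)%N.
  have far x : nV x <= (2 * j * 16 ^ j)%:R * nW y -> 2^-1 * nW y < nW (y - T x).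
    by move=> hx; case: (hy x) => // /negP; rewrite -ltNge.
  have y0 : 0 < nW y.
    rewrite lt0r hnorm_ge0 andbT; apply/negP => /eqP y0.
    by have := far 0; rewrite (hnorm0 ipVH) y0 bounded_op0 subr0 y0 !mulr0 ltxx => /(_ (lexx _)).
  pose a := q ^+ j / nW y; have a0 : 0 < a by rewrite divr_gt0.
  exists (a%:C *: y); split.
  - by exists (a%:C *: z); rewrite bounded_opZ Tz.
  - by rewrite (hnorm_scale ipWH) gtr0_norm// /a divfK// gt_eqF.
  - move=> x hx; have -> : x = a%:C *: (a^-1%:C *: x).
      by rewrite scalerA -rmorphM divff ?gt_eqF// rmorph1 scale1r.
    rewrite bounded_opZ -scalerBr (hnorm_scale ipWH) gtr0_norm//.
    rewrite mulrC -ltr_pdivrMl//; have -> : a^-1 * (2^-1 * q ^+ j) = 2^-1 * nW y.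
      rewrite /a; field; rewrite !gt_eqF//.
    apply: far; rewrite (hnorm_scale ipVH) gtr0_norm ?invr_gt0// natrM natrX.
    rewrite ler_pdivrMl//.
    have -> : a * ((2 * j)%:R * 16 ^+ j * nW y) = (2 * j)%:R * (q ^+ j * 16 ^+ j).
      by rewrite /a; field; rewrite gt_eqF.
    by rewrite -exprMn /q mulVf ?pnatr_eq0// expr1n mulr1.
have {hump bad} [y hy] := choice hump.
pose far j z := forall x, nV x <= j%:R -> q ^+ j / 4 < nW (z - T x).
(* A hump is added only if the partial sum is still close to the image of the ball of radius [i]. *)
pose z := fix z (j : nat) : W :=
  if j is i.+1 then if `[< far i (z i) >] then z i else z i + y i else 0.
have z_range j : rangeT (z j).
  elim: j => [|j [w hw]] /=; first by exists 0; rewrite bounded_op0.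
  case: asboolP => _; first by exists w.
  by have [[x hx] _ _] := hy j; exists (w + x); rewrite bounded_opD hw hx.
have z_step j : nW (z j.+1 - z j) <= 1 * q ^+ j.
  rewrite /= mul1r; case: asboolP => _; first by rewrite subrr (hnorm0 ipWH) ltW.
  by rewrite addrC addKr; have [_ -> _] := hy j.
have z_far j : far j (z j.+1).
  (* If [z j] and [z j + y j] were both within $q^j/4$ of images of points of norm at most $j$, then
     [y j] would be within $q^j/2$ of the image of their difference, of norm at most $2j$. *)
  rewrite /=; case: asboolP => // /existsNP[x0 /not_implyP[x0j /negP]].
  rewrite -leNgt => hx0 x xj; rewrite ltNge; apply/negP => hx.
  have [_ _ /(_ (x - x0))] := hy j; rewrite natrM.
  have := hnorm_le_add ipVH x (- x0); rewrite (hnorm_opp ipVH) => tri.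
  have le2 : nV (x - x0) <= 2 * j%:R by move: tri xj x0j; lra.
  move=> /(_ le2); apply/negP; rewrite -leNgt.
  have -> : y j - T (x - x0) = (z j + y j - T x) - (z j - T x0).
    rewrite bounded_opB !opprB [z j + y j]addrC -!addrA; congr (_ + _).
    by rewrite [RHS]addrCA [z j + _]addrC subrK addrC.
  rewrite (le_trans (hnorm_le_add ipWH _ _))// (hnorm_opp ipWH); lra.
have [|w /clT + hw] := geometric_converges ipWH ler01 _ z_step.
  by rewrite /q; apply/andP; split; lra.
move=> /(_ z_range)[x Tx].
(* The limit is some [T x]. At an index $j\ge\|x\|$ the tail bound $2q^{j+1}=q^j/8$ contradicts the
   distance $q^j/4$. *)
have xj : nV x <= (Num.bound (nV x))%:R by rewrite ltW// archi_boundP// hnorm_ge0.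
have := z_far _ _ xj; have := hw (Num.bound (nV x)).+1.
rewrite -Tx (hnorm_subC ipWH) exprS mulr1.
have := q_gt0 (Num.bound (nV x)); rewrite /q; lra.
Qed.

(** Successive approximation: each correction halves the residual, and the corrections sum to a
    preimage of norm at most $2C\|y\|$. Injectivity identifies it with the given one. *)
Lemma closed_range_bounded_below : (forall x, T x = 0 -> x = 0) ->
  closed_set rangeT -> bounded_below.
Proof.
move=> inj /closed_range_approx[C hC].
have : forall y, exists x, rangeT y -> nV x <= C%:R * nW y /\ nW (y - T x) <= 2^-1 * nW y.
  move=> y; have [/hC[x h1 h2]|nr] := pselect (rangeT y); first by exists x.
  by exists 0.
(* The summand 1 keeps the denominator positive when $C=0$. *)
move=> /choice[g hg]; exists (2 * C%:R + 1)^-1; first by rewrite invr_gt0 ltr_wpDl ?mulr_ge0.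
move=> x0; set y := T x0.
pose s := fix s (j : nat) : V := if j is i.+1 then s i + g (y - T (s i)) else 0.
have res_range j : rangeT (y - T (s j)) by exists (x0 - s j); rewrite bounded_opB.
have res_small j : nW (y - T (s j)) <= nW y * 2^-1 ^+ j.
  elim: j => [|j IH]; first by rewrite /= bounded_op0 subr0 mulr1.
  rewrite /= bounded_opD opprD addrA.
  have [_ h] := hg _ (res_range j); rewrite (le_trans h)// exprS; lra.
have s_step j : nV (s j.+1 - s j) <= C%:R * nW y * 2^-1 ^+ j.
  rewrite /= addrC addKr; have [h _] := hg _ (res_range j); rewrite (le_trans h)//.
  by rewrite -mulrA ler_wpM2l.
have [|/=|x sx hx] := geometric_converges ipVH _ _ s_step; first by rewrite mulr_ge0 ?hnorm_ge0.
  by rewrite lexx andbT invr_ge0.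
have Tx : T x = y.
  apply: (converges_unique ipWH (bounded_op_converges sx)).
  apply/converges_nvs_of => e e0; have [N hN] := half_power_small (nW y) e0.
  by exists N => m Nm; rewrite (hnorm_subC ipWH) (le_lt_trans (res_small m))// hN.
have xx0 : x = x0.
  by apply/eqP; rewrite -subr_eq0; apply/eqP/inj; rewrite bounded_opB Tx subrr.
rewrite ler_pdivrMl ?ltr_wpDl ?mulr_ge0//.
have := hx 0%N; rewrite /= subr0 xx0 mulr1 => h; have := hnorm_ge0 ipW y; nra.
Qed.

Lemma bounded_below_inj : bounded_below -> forall x, T x = 0 -> x = 0.
Proof.
move=> [c c0 h] x Tx; apply: (hnorm0_eq0 ipVH); apply/eqP.
rewrite eq_le hnorm_ge0 andbT -(pmulr_rle0 _ c0).
by have := h x; rewrite Tx (hnorm0 ipWH).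
Qed.

End Operators.

(** * Orthogonal projection *)

Section Projection.
Variables (R : realType) (V : lmodType R[i]) (ip : V -> V -> R[i]).
Hypothesis ipH : is_hilbert ip.
Local Notation nm := (hnorm ip).
Variable S : set V.
Hypotheses (subS : subspace (V := nvs_of ip) S) (clS : closed_set (V := nvs_of ip) S).

(** A minimizing sequence is Cauchy by the parallelogram law, its limit [p] attains the distance
    [d], and minimality forces orthogonality. *)
Lemma projection (y : V) : exists2 p, S p & forall s, S s -> rip ip (y - p) s = 0.
Proof.
have [S0 [SD SZ]] := subS; rewrite /= in S0 SD SZ.
have SB s t : S s -> S t -> S (s - t).
  by move=> Ss St; apply: SD => //; rewrite -scaleN1r; apply: SZ.
pose E := [set nm (y - s) | s in S]; pose d := inf E.
have E_inf : has_inf E.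
  split; first by exists (nm (y - 0)), 0.
  by exists 0 => _ [s _ <-]; exact: hnorm_ge0.
have d_le s : S s -> d <= nm (y - s).
  by move=> Ss; apply: ge_inf; [case: E_inf|exists s].
have d_ge0 : 0 <= d by apply: lb_le_inf; [case: E_inf|move=> _ [s _ <-]; exact: hnorm_ge0].
pose q : R := 4^-1.
have q_gt0 j : 0 < q ^+ j by rewrite exprn_gt0// invr_gt0.
have : forall j, exists s, S s /\ nm (y - s) < d + q ^+ j.
  by move=> j; have [_ [s Ss <-] hs] := inf_adherent (q_gt0 j) E_inf; exists s.
move=> /choice[s hs].
have s_step j : nm (s j.+1 - s j) <= (2 * (d + 1)) * 2^-1 ^+ j.
  have [Ss1 h1] := hs j.+1; have [Ss0 h0] := hs j.
  (* The midpoint stays in [S], so its distance to [y] is at least [d]; this bounds $\|a+b\|$ from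
     below in the parallelogram law. *)
  have Sm : S ((2^-1 : R)%:C *: (s j + s j.+1)) by apply: SZ; apply: SD.
  have hm := d_le _ Sm.
  set a := y - s j; set b := y - s j.+1.
  have ab : s j.+1 - s j = a - b by rewrite /a /b opprB [RHS]addrC addrA subrK.
  have hab : nm (a + b) = 2 * nm (y - (2^-1 : R)%:C *: (s j + s j.+1)).
    rewrite -[X in _ = X * _](@ger0_norm _ 2)// -(hnorm_scale ipH); congr (nm _).
    rewrite scalerBr scalerA -rmorphM divff ?pnatr_eq0// rmorph1 scale1r.
    by rewrite rmorph_nat scaler_nat mulr2n /a /b addrACA opprD.
  have := hnorm_add_sqr ipH a b; have := hnorm_sub_sqr ipH a b.
  rewrite -ab -(ler_pXn2r (n := 2)) ?nnegrE ?mulr_ge0 ?hnorm_ge0 ?addr_ge0 ?exprn_ge0 ?invr_ge0//.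
  have q1 : q ^+ j <= 1 by rewrite exprn_ile1// /q; lra.
  have q2 : (2^-1 ^+ j : R) ^+ 2 = q ^+ j.
    by rewrite exprAC; congr (_ ^+ _); rewrite /q; field.
  rewrite exprMn q2 hab; move: hm h1 h0; rewrite -/a -/b exprS.
  have := q_gt0 j; have := hnorm_ge0 ip a; have := hnorm_ge0 ip b.
  move: q1; rewrite {1 3 4 5}/q.
  set m := nm (y - _); set x := nm a; set z := nm b; set t := q ^+ j.
  move=> t1 z0 x0 t0 dm zd xd eB eD.
  (* Since $t\le 1$, $(d+t)^2\le d^2+t(2d+1)$. The squared step is then at most
     $4t(2d+1)\le(2(d+1))^2t$, and $t=4^{-j}$ gives the ratio $1/2$. *)
  have x2 : x ^+ 2 <= d ^+ 2 + t * (2 * d + 1) by nra.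
  have z2 : z ^+ 2 <= d ^+ 2 + t * (2 * d + 1) by nra.
  have m2 : d ^+ 2 <= m ^+ 2 by nra.
  have : nm (s j.+1 - s j) ^+ 2 <= 4 * (t * (2 * d + 1)) by nra.
  have : 0 <= t * d ^+ 2 by rewrite mulr_ge0 ?sqr_ge0 ?ltW.
  nra.
have [||p sp hp] := geometric_converges ipH _ _ s_step.
- by rewrite mulr_ge0 ?addr_ge0.
- by rewrite lexx andbT invr_ge0.
have Sp : S p by apply: clS sp => m; have [] := hs m.
have pd : nm (y - p) <= d.
  apply/ler_addgt0Pr => e e0.
  (* The excess over [d] is at most $4^{-N}$ from the choice of [s N] plus $2\cdot 2(d+1)2^{-N}$
     from the convergence to [p]. *)
  have [N /(_ N (leqnn N)) hN] := half_power_small (1 + 2 * (2 * (d + 1))) e0.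
  have [_ hsN] := hs N; have := hp N; have := hnorm_triangle ipH y (s N) p.
  rewrite (hnorm_subC ipH (s N)).
  have : q ^+ N <= 2^-1 ^+ N by rewrite lerXn2r ?nnegrE ?invr_ge0// /q; lra.
  lra.
exists p => // x Sx.
apply/eqP; apply: contraT => r0.
have x0 : 0 < nm x ^+ 2.
  rewrite exprn_gt0// lt0r hnorm_ge0 andbT; apply: contra r0 => /eqP /(hnorm0_eq0 ipH) ->.
  by rewrite (ripC ipH) /rip (ip0l ipH).
(* This [t] minimizes $\|y-p-tx\|^2$ and lowers it by $tr=r^2/\|x\|^2$, contradicting minimality of
   [d] unless $r=0$. *)
set r := rip _ _ _ in r0; pose t := r / nm x ^+ 2.
have tx : t * nm x ^+ 2 = r by rewrite divfK// gt_eqF.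
have Spt : S (p + t%:C *: x) by apply: SD => //; apply: SZ.
have := d_le _ Spt; rewrite opprD addrA => le1.
have := hnorm_sub_sqr ipH (y - p) (t%:C *: x).
rewrite (ripZr ipH) -/r (hnorm_scale ipH) exprMn real_normK ?num_real//.
have n0 := hnorm_ge0 ip (y - p).
have le2 : nm (y - p) ^+ 2 <= nm (y - p - t%:C *: x) ^+ 2.
  by rewrite ler_pXn2r ?nnegrE ?hnorm_ge0//; apply: le_trans le1.
have tr : 0 < t * r by rewrite /t mulrAC -expr2 divr_gt0// lt0r sqrf_eq0 r0 sqr_ge0.
rewrite (_ : t ^+ 2 * nm x ^+ 2 = t * r) -?tx; last by ring.
rewrite tx; nra.
Qed.

(** The complement is the orthogonal complement, defined through the real part only; this is enough
    because [S] is stable under complex scalars. *)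
Lemma closed_subspace_complemented : complemented (V := nvs_of ip) S.
Proof.
have [S0 [SD SZ]] := subS; rewrite /= in S0 SD SZ.
exists [set w | forall s, S s -> rip ip w s = 0]; split; [split; [|split]|split; [|split]].
- by move=> s _; rewrite /rip (ip0l ipH).
- by move=> x y hx hy s Ss; rewrite (ripDl ipH) hx// hy// addr0.
(* The scalar moves to the other argument: $\mathrm{Re}\langle ax,s\rangle=\mathrm{Re}\langle x,\bar
   a s\rangle$ with $\bar a s\in S$. *)
- move=> a x hx s Ss; have /hx <- : S (conjc a *: s) by apply: SZ.
  by rewrite /rip (ipZl ipH) (ipZr ipH) conjcK.
- move=> u x hu /converges_nvs_of ux s Ss; apply/eqP; rewrite -normr_eq0.
  rewrite eq_le normr_ge0 andbT; apply/ler_addgt0Pr => e e0; rewrite add0r.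
  have s0 : 0 < nm s + 1 by rewrite ltr_wpDl ?hnorm_ge0.
  have [N /(_ N (leqnn N)) hN] := ux _ (divr_gt0 e0 s0).
  have -> : rip ip x s = rip ip (x - u N) s by rewrite (ripDl ipH) (ripNl ipH) (hu N)// subr0.
  rewrite ltr_pdivlMr// in hN.
  have := cauchy_schwarz ipH (x - u N) s; have := cauchy_schwarz ipH (u N - x) s.
  rewrite -[u N - x]opprB (ripNl ipH) (hnorm_opp ipH) (hnorm_subC ipH x).
  have := hnorm_ge0 ip (u N - x); rewrite ler_norml; nra.
- by move=> x Sx /(_ x Sx) /(rip_eq0 ipH).
- move=> x; have [p Sp hp] := projection x.
  by exists p, (x - p); split=> //; split=> //=; rewrite addrC subrK.
Qed.

End Projection.

(** * Left invertibility and boundedness below *)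

Section LeftInvertible.
Variables (R : realType) (V W : lmodType R[i]).
Variables (ipV : V -> V -> R[i]) (ipW : W -> W -> R[i]).
Hypotheses (ipVH : is_hilbert ipV) (ipWH : is_hilbert ipW).
Variable T : V -> W.
Hypothesis Tb : bounded_op ipV ipW T.
Local Notation nV := (hnorm ipV).
Local Notation nW := (hnorm ipW).
Local Notation rangeT := (Defs.range (U := nvs_of ipV) (W := nvs_of ipW) T).

Lemma range_subspace : subspace rangeT.
Proof.
split; [|split].
- by exists 0; rewrite (bounded_op0 Tb).
- by move=> _ _ [x <-] [y <-]; exists (x + y); rewrite (bounded_opD Tb).
- by move=> a _ [x <-]; exists (a *: x); rewrite (bounded_opZ Tb).
Qed.

(** Preimages of a convergent sequence are Cauchy, because $c\|x_m-x_p\|\le\|u_m-u_p\|$; the image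
    of their limit is the limit of the sequence. *)
Lemma bounded_below_closed_range : bounded_below ipV ipW T -> closed_set rangeT.
Proof.
move=> [c c0 hc] u y /choice[x xu] uy; have /converges_nvs_of h := uy.
have [z hz] : exists z, forall e : R, 0 < e -> exists N, forall m, (N <= m)%N -> nV (x m - z) < e.
  case: (ipVH) => _ [_ [_ [_]]]; apply=> e e0.
  have [N hN] := h _ (divr_gt0 (mulr_gt0 c0 e0) (ltr0Sn R 1)).
  exists N => m p /hN hm /hN hp; rewrite -(ltr_pM2l c0).
  rewrite (le_lt_trans (hc _))// (bounded_opB Tb) !xu.
  have := hnorm_triangle ipWH (u m) y (u p); rewrite (hnorm_subC ipWH y); lra.
exists z; apply: (converges_unique ipWH) uy.
have -> : u = T \o x by apply/funext => m /=; rewrite xu.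
by apply: (bounded_op_converges Tb); apply/converges_nvs_of.
Qed.

Lemma left_invertibleP :
  left_invertible (U := nvs_of ipV) (W := nvs_of ipW) T <-> bounded_below ipV ipW T.
Proof.
split=> [[/(alpha_eq0 ipV ipW T) inj [clT _]]|bb].
  exact: (closed_range_bounded_below ipVH ipWH Tb).
have clT := bounded_below_closed_range bb; split; [|split=> //].
  by apply/(alpha_eq0 ipV ipW T); exact: (bounded_below_inj ipVH ipWH).
exact: (closed_subspace_complemented ipWH range_subspace).
Qed.

End LeftInvertible.

(** * Direct sums *)

(** A named copy of the carrier of [dsum], to which the module structure can be attached; the
    Hilbert space lemmas then apply to the direct sum. *)
Definition pi_space (I : Type) (K : nzRingType) (X : I -> lmodType K) : Type := forall i, X i.

Section PiSpace.
Variables (I : Type) (K : nzRingType) (X : I -> lmodType K).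
Local Notation pi := (pi_space X).

HB.instance Definition _ := gen_eqMixin pi.
HB.instance Definition _ := gen_choiceMixin pi.

Definition pi_zero : pi := fun k => 0.
Definition pi_opp (x : pi) : pi := fun k => - x k.
Definition pi_add (x y : pi) : pi := fun k => x k + y k.
Definition pi_scale (a : K) (x : pi) : pi := fun k => a *: x k.

Fact pi_addA : associative pi_add.
Proof. by move=> x y z; apply/functional_extensionality_dep => k; exact: addrA. Qed.
Fact pi_addC : commutative pi_add.
Proof. by move=> x y; apply/functional_extensionality_dep => k; exact: addrC. Qed.
Fact pi_add0 : left_id pi_zero pi_add.
Proof. by move=> x; apply/functional_extensionality_dep => k; exact: add0r. Qed.
Fact pi_addN : left_inverse pi_zero pi_opp pi_add.
Proof. by move=> x; apply/functional_extensionality_dep => k; exact: addNr. Qed.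
HB.instance Definition _ := GRing.isZmodule.Build pi pi_addA pi_addC pi_add0 pi_addN.

Fact pi_scaleA a b v : pi_scale a (pi_scale b v) = pi_scale (a * b) v.
Proof. by apply/functional_extensionality_dep => k; exact: scalerA. Qed.
Fact pi_scale1 : left_id 1 pi_scale.
Proof. by move=> x; apply/functional_extensionality_dep => k; exact: scale1r. Qed.
Fact pi_scaleDr : right_distributive pi_scale +%R.
Proof. by move=> a x y; apply/functional_extensionality_dep => k; exact: scalerDr. Qed.
Fact pi_scaleDl v : {morph pi_scale^~ v : a b / a + b}.
Proof. by move=> a b; apply/functional_extensionality_dep => k; exact: scalerDl. Qed.
HB.instance Definition _ := GRing.Zmodule_isLmodule.Build K pi
  pi_scaleA pi_scale1 pi_scaleDr pi_scaleDl.

Lemma pi_sumE (J : Type) (r : seq J) (P : pred J) (f : J -> pi) k :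
  (\sum_(j <- r | P j) f j) k = \sum_(j <- r | P j) f j k.
Proof. by elim/big_rec2: _ => // j x y _ <-. Qed.

End PiSpace.

Section Single.
Variables (I : finType) (K : nzRingType) (X : I -> lmodType K).

Definition single (k : I) (v : X k) : pi_space X := dfwith (fun j => 0 : X j) v.

Lemma single_same k (v : X k) : single v k = v.
Proof. exact: dfwith_in. Qed.

Lemma single_other k (v : X k) j : j != k -> single v j = 0.
Proof. by move=> jk; apply: dfwith_out; rewrite eq_sym. Qed.

End Single.

Section DirectSum.
Variables (R : realType) (n : nat) (X : 'I_n -> lmodType R[i]).
Variable ip : forall k, X k -> X k -> R[i].
Hypothesis ipH : forall k, is_hilbert (@ip k).
Local Notation pi := (pi_space X).
Local Notation nm k := (hnorm (@ip k)).

Definition pi_ip (x y : pi) : R[i] := \sum_k ip (x k) (y k).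
Local Notation npi := (hnorm pi_ip).

Lemma pi_hnorm (x : pi) : npi x = Num.sqrt (\sum_k nm k (x k) ^+ 2).
Proof.
rewrite /hnorm /pi_ip raddf_sum; congr Num.sqrt; apply: eq_bigr => k _.
by rewrite -/(hnorm _ _) (hnorm_sqr (ipH k)).
Qed.

Lemma pi_hnorm_ge (x : pi) k : nm k (x k) <= npi x.
Proof.
rewrite pi_hnorm -[leLHS](ger0_norm (hnorm_ge0 _ _)) -sqrtr_sqr.
by rewrite ler_wsqrtr// (bigD1 k)//= lerDl sumr_ge0// => j _; exact: sqr_ge0.
Qed.

Lemma pi_hnorm_single k (v : X k) : npi (single v) = nm k v.
Proof.
rewrite pi_hnorm (bigD1 k)//= single_same big1 => [|j jk].
  by rewrite addr0 sqrtr_sqr ger0_norm// hnorm_ge0.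
by rewrite single_other// (hnorm0 (ipH j)) expr0n.
Qed.

Lemma pi_hnorm_le (x : pi) : npi x <= \sum_k nm k (x k).
Proof.
have s0 : 0 <= \sum_k nm k (x k) by apply: sumr_ge0 => k _; exact: hnorm_ge0.
rewrite pi_hnorm -(ler_pXn2r (n := 2)) ?nnegrE ?sqrtr_ge0//.
rewrite sqr_sqrtr; last by apply: sumr_ge0 => k _; exact: sqr_ge0.
suff [] : \sum_k nm k (x k) ^+ 2 <= (\sum_k nm k (x k)) ^+ 2 /\
    0 <= \sum_k nm k (x k) by [].
elim/big_rec2 : _ => [|k b a _ [ab b0]]; first by rewrite expr0n.
have := hnorm_ge0 (@ip k) (x k); split; last exact: addr_ge0.
by rewrite sqrrD -addrA lerD2l (le_trans ab)// lerDr mulrn_wge0// mulr_ge0.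
Qed.

Lemma pi_hilbert : is_hilbert pi_ip.
Proof.
split; [|split; [|split; [|split]]].
- move=> a x y z; rewrite /pi_ip mulr_sumr -big_split; apply: eq_bigr => k _ /=.
  by rewrite (ipDl (ipH k)) (ipZl (ipH k)).
- move=> x y; rewrite /pi_ip rmorph_sum; apply: eq_bigr => k _ /=.
  exact: ip_conj (ipH k) _ _.
- move=> x; rewrite /pi_ip raddf_sum; apply: sumr_ge0 => k _; exact: rip_ge0 (ipH k) _.
- move=> x /(congr1 (@complex.Re R)); rewrite /pi_ip raddf_sum /= => /psumr_eq0P h.
  apply/functional_extensionality_dep => k; apply: (rip_eq0 (ipH k)).
  by apply: h => // j _; exact: rip_ge0 (ipH j) _.
- move=> u hu.
  have lim k : {y : X k | forall e : R, 0 < e -> exists N, forall m, (N <= m)%N ->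
      nm k (u m k - y) < e}.
    apply: cid; case: (ipH k) => _ [_ [_ [_]]]; apply=> e /hu[N hN].
    exists N => m p Nm Np; exact: le_lt_trans (pi_hnorm_ge (u m - u p) k) (hN _ _ Nm Np).
  exists (fun k => projT1 (lim k)) => e e0.
  (* Dividing by $n+1$ keeps the sum of [n] coordinate errors strictly below [e], also for $n=0$. *)
  have en0 : 0 < e / n.+1%:R by rewrite divr_gt0.
  have : forall k, exists N, forall m, (N <= m)%N ->
      nm k (u m k - projT1 (lim k)) < e / n.+1%:R.
    by move=> k; exact: (projT2 (lim k)).
  move=> /choice[N hN]; exists (\max_k N k)%N => m hm.
  rewrite (le_lt_trans (pi_hnorm_le _))//.
  apply: (@le_lt_trans _ _ (\sum_(k < n) e / n.+1%:R)).
    by apply: ler_sum => k _; apply/ltW/hN/(leq_trans _ hm)/leq_bigmax.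
  rewrite sumr_const card_ord -[_ *+ n]mulr_natr mulrAC ltr_pdivrMr// ltr_pM2l//.
  by rewrite ltr_nat.
Qed.

End DirectSum.

(** * Triangular operators *)

Section Triangular.
Variables (R : realType) (n : nat) (X : 'I_n -> lmodType R[i]).
Variable ip : forall k, X k -> X k -> R[i].
Hypothesis ipH : forall k, is_hilbert (@ip k).
Variables (D : forall k, X k -> X k) (A : forall i j : 'I_n, X j -> X i).
Hypothesis Db : forall k, bounded_op (@ip k) (@ip k) (@D k).
Hypothesis Ab : forall i j : 'I_n, (i < j)%N -> bounded_op (@ip j) (@ip i) (@A i j).
Local Notation pi := (pi_space X).
Local Notation nm k := (hnorm (@ip k)).
Local Notation npi := (hnorm (pi_ip ip)).

Let T : pi -> pi := Tmat (ip := ip) D A.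

(** The two spaces share their operations by conversion, so only the norms have to be identified;
    [F] abstracts over the norm. *)
Lemma dsum_left_invertible (S : pi -> pi) :
  left_invertible (U := dsum ip) (W := dsum ip) S <->
  left_invertible (U := nvs_of (pi_ip ip)) (W := nvs_of (pi_ip ip)) S.
Proof.
pose F nrm := @left_invertible R (@NVS R pi 0 +%R *:%R nrm) (@NVS R pi 0 +%R *:%R nrm) S.
suff E : (fun x : pi => Num.sqrt (\sum_(k < n) nm k (x k) ^+ 2)) = npi.
  by change (F (fun x : pi => Num.sqrt (\sum_(k < n) nm k (x k) ^+ 2)) <-> F npi); rewrite E.
by apply/funext => x; rewrite (pi_hnorm ipH).
Qed.

Lemma Tmat_bounded : bounded_op (pi_ip ip) (pi_ip ip) T.
Proof.
split=> [a x y|].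
  apply/functional_extensionality_dep => k.
  rewrite /T /Tmat /= (bounded_opD (Db k)) (bounded_opZ (Db k)).
  rewrite [RHS](_ : _ = a *: (D (x k) + \sum_(j < n | (k < j)%N) A k (x j)) +
    (D (y k) + \sum_(j < n | (k < j)%N) A k (y j)))// scalerDr addrACA.
  congr (_ + _); rewrite scaler_sumr -big_split; apply: eq_bigr => j kj.
  by rewrite /= (bounded_opD (Ab kj)) (bounded_opZ (Ab kj)).
have /choice[MD hD] : forall k, exists M, forall x, nm k (D x) <= M * nm k x.
  by move=> k; have [M _ hM] := bounded_op_bound (Db k); exists M.
have /choice[MA hA] : forall p : 'I_n * 'I_n, exists M,
    0 <= M /\ forall x, (p.1 < p.2)%N -> nm p.1 (A p.1 x) <= M * nm p.2 x.
  (* Nothing is known of [A i j] on or below the diagonal; the bound 0 is a placeholder there. *)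
  move=> [i j]; have [ij|ji] := boolP (i < j)%N; last by exists 0; split=> // x; rewrite (negbTE ji).
  by have [M M0 hM] := bounded_op_bound (Ab ij); exists M; split=> [|x _]; rewrite ?hM// ltW.
exists (\sum_k (`|MD k| + \sum_(j < n | (k < j)%N) MA (k, j))) => x.
rewrite (le_trans (pi_hnorm_le ipH _))// mulr_suml; apply: ler_sum => k _.
rewrite (le_trans (hnorm_le_add (ipH k) _ _))// mulrDl lerD//.
  rewrite (le_trans (hD k _))// (le_trans (ler_wpM2r (hnorm_ge0 _ _) (ler_norm _)))//.
  by rewrite ler_wpM2l// pi_hnorm_ge.
rewrite (le_trans (hnorm_sum (ipH k) _ _))// mulr_suml; apply: ler_sum => j kj.
have [M0 hM] := hA (k, j); rewrite (le_trans (hM _ kj))//.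
by rewrite ler_wpM2l// pi_hnorm_ge.
Qed.

Lemma Tmat_congr (x y : pi) (i : 'I_n) :
  (forall j : 'I_n, (i <= j)%N -> x j = y j) -> T x i = T y i.
Proof.
move=> xy; rewrite /T /Tmat xy//; congr (_ + _).
by apply: eq_bigr => j ij; rewrite xy// ltnW.
Qed.

Lemma Tmat_single k (v : X k) : T (single v) k = D v.
Proof.
rewrite /T /Tmat single_same big1 ?addr0// => j kj.
by rewrite single_other ?(bounded_op0 (Ab kj))// -val_eqE gtn_eqF.
Qed.

Lemma Tmat_single_below k (v : X k) (j : 'I_n) : (k < j)%N -> T (single v) j = 0.
Proof.
move=> kj; rewrite -[RHS]/((0 : pi) j) -(bounded_op0 Tmat_bounded).
apply: Tmat_congr => l jl; rewrite single_other// -val_eqE gtn_eqF//.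
exact: leq_trans jl.
Qed.

(** Coordinates are bounded from the last one upwards, through
    $D_kx_k=(Tx)_k-\sum_{j>k}A_{kj}x_j$. *)
Lemma Tmat_bounded_below : (forall k, bounded_below (@ip k) (@ip k) (@D k)) ->
  bounded_below (pi_ip ip) (pi_ip ip) T.
Proof.
move=> Dbb.
(* Induction on [p] reaches the last [p] coordinates; $p=0$ is vacuous. *)
have coord p : forall k : 'I_n, (n <= k + p)%N ->
    exists C, 0 <= C /\ forall x : pi, nm k (x k) <= C * npi (T x).
  elim: p => [|p IH] k nk; first by have := ltn_ord k; rewrite ltnNge -[X in (n <= X)%N]addn0 nk.
  have : forall j : 'I_n, exists C, (k < j)%N ->
      0 <= C /\ forall x : pi, nm k (A k (x j)) <= C * npi (T x).
    move=> j; have [kj|jk] := boolP (k < j)%N; last by exists 0.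
    have [|C [C0 hC]] := IH j.
      by rewrite (leq_trans nk)// addnS -addSn leq_add2r.
    have [M M0 hM] := bounded_op_bound (Ab kj).
    exists (M * C) => _; split=> [|x]; first by rewrite mulr_ge0// ltW.
    by rewrite (le_trans (hM _))// -mulrA ler_wpM2l// ltW.
  move=> /choice[C hC]; have [c c0 hc] := Dbb k.
  have S0 : 0 <= \sum_(j < n | (k < j)%N) C j by apply: sumr_ge0 => j /hC[].
  exists ((1 + \sum_(j < n | (k < j)%N) C j) / c); split=> [|x].
    by rewrite divr_ge0 ?addr_ge0// ltW.
  rewrite mulrAC ler_pdivlMr// mulrC (le_trans (hc _))//.
  have -> : D (x k) = T x k - \sum_(j < n | (k < j)%N) A k (x j).
    by rewrite /T /Tmat addrK.
  rewrite (le_trans (hnorm_le_add (ipH k) _ _))// (hnorm_opp (ipH k)) mulrDl mul1r.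
  rewrite lerD ?pi_hnorm_ge// (le_trans (hnorm_sum (ipH k) _ _))// mulr_suml.
  by apply: ler_sum => j /hC[].
have /choice[C hC] : forall k : 'I_n, exists C, 0 <= C /\ forall x : pi, nm k (x k) <= C * npi (T x).
  by move=> k; apply: (coord n); rewrite leq_addl.
have S0 : 0 <= \sum_k C k by apply: sumr_ge0 => k _; case: (hC k).
exists (1 + \sum_k C k)^-1; first by rewrite invr_gt0 ltr_pwDl.
move=> x; rewrite ler_pdivrMl ?ltr_pwDl// (le_trans (pi_hnorm_le ipH _))//.
rewrite mulrDl mul1r ler_wpDl ?hnorm_ge0// mulr_suml.
by apply: ler_sum => k _; case: (hC k).
Qed.

(** [T] maps the first summand into itself and acts there as its diagonal entry. *)
Lemma Tmat_bounded_below_first (k : 'I_n) : k = 0%N :> nat ->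
  bounded_below (pi_ip ip) (pi_ip ip) T -> bounded_below (@ip k) (@ip k) (@D k).
Proof.
move=> k0 [c c0 hc]; exists c => // v.
rewrite -(pi_hnorm_single ipH) (le_trans (hc _))//.
have -> : T (single v) = single (D v); last by rewrite (pi_hnorm_single ipH).
apply/functional_extensionality_dep => j; have [->|jk] := eqVneq j k.
  by rewrite Tmat_single single_same.
by rewrite single_other// Tmat_single_below// k0 lt0n -k0 val_eqE.
Qed.

(** Rows are corrected in the order $k-1,\dots,0$. Changing coordinate [s] leaves all rows of larger
    index unchanged, so earlier corrections persist. *)
Lemma back_substitution (S : forall s, set (X s)) (k : 'I_n) (x0 : pi) :
  (forall s : 'I_n, (s < k)%N -> forall y, exists x, S s (y + D x)) ->
  exists x : pi, (forall j : 'I_n, (k <= j)%N -> x j = x0 j) /\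
    forall s : 'I_n, (s < k)%N -> S s (T x s).
Proof.
move=> hS; suff H p : exists x : pi, (forall j : 'I_n, (k <= j)%N -> x j = x0 j) /\
    forall s : 'I_n, (k <= s + p)%N -> (s < k)%N -> S s (T x s).
  by have [x [h1 h2]] := H k; exists x; split=> // s; apply: h2; rewrite leq_addl.
elim: p => [|p [x [xk hx]]].
  by exists x0; split=> // s; rewrite addn0 leqNgt => /negP.
have [pk|kp] := ltnP p k; last first.
  by exists x; split=> // s _; apply: hx; rewrite (leq_trans kp)// leq_addl.
have t_lt : (k - p.+1 < n)%N by rewrite (leq_ltn_trans (leq_subr _ _)).
(* The [p] rows just before [k] are already in place; [t] is the next one up. *)
pose t := Ordinal t_lt; have tk : (t < k)%N by rewrite /= ltn_subrL (leq_ltn_trans _ pk).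
have [v hv] := hS t tk (T x t).
exists (x + single v); split=> [j kj|s ks sk].
  rewrite -[LHS]/(x j + single v j) single_other ?addr0 ?xk// -val_eqE gtn_eqF//.
  exact: leq_trans kj.
have -> : T (x + single v) s = T x s + T (single v) s by rewrite (bounded_opD Tmat_bounded).
have [->|st] := eqVneq s t; first by rewrite Tmat_single.
have ts : (t < s)%N.
  by rewrite ltn_neqAle eq_sym val_eqE st /= leq_subLR addnC.
rewrite Tmat_single_below// addr0; apply: hx => //.
by move: (ts); rewrite /= ltn_subLR ?(leq_ltn_trans _ ts)// addSn ltnS addnC.
Qed.

End Triangular.

(** * The kernel of a triangular operator *)

Lemma enat_sum_Some (I : eqType) (r : seq I) (P : pred I) (f : I -> enat) N :
  \big[enat_add/Some 0%N]_(s <- r | P s) f s = Some N ->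
  N = (\sum_(s <- r | P s) odflt 0 (f s))%N /\
  forall s, s \in r -> P s -> f s = Some (odflt 0%N (f s)).
Proof.
elim: r N => [|t r IH] N; first by rewrite !big_nil => -[<-].
rewrite !big_cons; case: ifPn => Pt; last first.
  move=> /IH[-> h]; split=> // s; rewrite inE => /orP[/eqP->|/h//].
  by rewrite (negbTE Pt).
case ft : (f t) => [a|//]; case e : (\big[_/_]_(s <- r | P s) f s) => [M|//] [<-].
have [-> h] := IH _ e; split=> // s; rewrite inE => /orP[/eqP->|/h//].
by rewrite ft.
Qed.

(** Take a maximal system [w] independent modulo [S]. Adjoining [y] makes it dependent, and the
    coefficient of [y] is nonzero by independence of [w], so it can be divided out. *)
Lemma ecodim_span (R : realType) (V : lmodType R[i]) (ip : V -> V -> R[i]) (S : set V) b :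
  subspace (V := nvs_of ip) S -> ecodim (V := nvs_of ip) S = Some b ->
  exists w : 'I_b -> V, forall y, exists c : 'I_b -> R[i], S (y - \sum_i c i *: w i).
Proof.
move=> [_ [_ SZ]] e; have [|[w hw] max] := edim_of_Some _ e.
  by exists (fun=> 0) => c _ [].
exists w => y; rewrite /lcomb /= in hw.
pose v (i : 'I_b.+1) := if unlift ord0 i is Some j then w j else y.
have : ~ indep_mod (V := nvs_of ip) S b.+1 by move=> /max; rewrite ltnn.
move=> /forallNP /(_ v) /existsNP[c /not_implyP[]]; rewrite /lcomb big_ord_recl /=.
rewrite {1}/v unlift_none; under eq_bigr do rewrite /v liftK.
move=> Sc /existsNP[i ci]; have [c0|c0] := eqVneq (c ord0) 0.
  exfalso; move: Sc; rewrite c0 scale0r add0r => /hw c1; apply: ci.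
  by case: (unliftP ord0 i) => [j|] ->.
exists (fun i => - ((c ord0)^-1 * c (lift ord0 i))).
have := SZ (c ord0)^-1 _ Sc; rewrite /= scalerDr scalerA mulVf// scale1r.
congr (S (_ + _)); rewrite scaler_sumr -sumrN; apply: eq_bigr => j _.
by rewrite scaleNr opprK scalerA.
Qed.

Section TriangularKernel.
Variables (R : realType) (n : nat) (X : 'I_n -> lmodType R[i]).
Variable ip : forall k, X k -> X k -> R[i].
Hypothesis ipH : forall k, is_hilbert (@ip k).
Variables (D : forall k, X k -> X k) (A : forall i j : 'I_n, X j -> X i).
Hypothesis Db : forall k, bounded_op (@ip k) (@ip k) (@D k).
Hypothesis Ab : forall i j : 'I_n, (i < j)%N -> bounded_op (@ip j) (@ip i) (@A i j).
Local Notation pi := (pi_space X).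
Let T : pi -> pi := Tmat (ip := ip) D A.
Local Notation nvs k := (nvs_of (@ip k)).
Local Notation alphaD k := (alpha (U := nvs k) (W := nvs k) (@D k)).
Local Notation betaD k := (beta (U := nvs k) (W := nvs k) (@D k)).

(* Back substitution modulo complements of the ranges R(D_s), s < k, lifts each vector of
   N(D_k) to a vector that T sends into a space of dimension sum_(s < k) beta(D_s);
   more than that many independent lifts have a combination killed by T. *)
Lemma injective_Tmat_alpha_le (k : 'I_n) : (forall x, T x = 0 -> x = 0) ->
  enat_le (alphaD k) (\big[enat_add/Some 0%N]_(s < n | (s < k)%N) betaD s).
Proof.
move=> inj; case sumE : (\big[_/_]_(s < n | _) _) => [N|]; last by case: (alphaD k).
apply: contrapT => gtN.
have {gtN} [m [v [kv indv]] Nm] : exists2 m,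
    indep_in (V := nvs k) (kernel (U := nvs k) (W := nvs k) (@D k)) m & (N < m)%N.
  move: gtN; rewrite /alpha /edim; case e : (edim_of _) => [a|]; last first.
    by move=> _; exact: (edim_of_None e N).
  have [|Pa _] := edim_of_Some _ e; first by exists (fun=> 0); split=> [[]//|c _ []//].
  by move=> /negP; rewrite -ltnNge; exists a.
have [NE betaE] := enat_sum_Some sumE.
(* Setting [b s] to 0 for $s\ge k$ lets one formula also say that the rows from [k] on vanish. *)
pose b (s : 'I_n) := if (s < k)%N then odflt 0%N (betaD s) else 0%N.
have span s : {w : 'I_(b s) -> X s | (s < k)%N ->
    forall y, exists x, exists c : 'I_(b s) -> R[i], y + D x = \sum_t c t *: w t}.
  apply: cid; rewrite /b; case: ifP => [sk|_]; last by exists (fun=> 0).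
  have /(ecodim_span (range_subspace (Db s)))[w hw] := betaE s (mem_index_enum _) sk.
  exists w => _ y; have [c [x Dx]] := hw y; exists (- x), c.
  by rewrite (bounded_opN (Db s)) Dx opprB addrC subrK.
pose w s := projT1 (span s).
have lift_ker i : {xc : pi * (forall s, 'I_(b s) -> R[i]) |
    xc.1 k = v i /\ forall s, T xc.1 s = \sum_t xc.2 s t *: w s t}.
  apply: cid; have [|x [xk hx]] := @back_substitution _ _ _ _ ipH D A Db Ab
    (fun s z => exists c : 'I_(b s) -> R[i], z = \sum_t c t *: w s t) k (single (v i)).
    by move=> s sk; exact: (projT2 (span s) sk).
  have Tx s : {c : 'I_(b s) -> R[i] | T x s = \sum_t c t *: w s t}.
    apply: cid; have [/hx//|ks] := ltnP s k; exists (fun=> 0).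
    rewrite big1 => [|t _]; last by rewrite scale0r.
    (* From row [k] on, [T x] agrees with the image of [single (v i)]: row [k] is $D_kv_i=0$, and
       later rows are zero by triangularity. *)
    have -> : T x s = T (single (v i)) s.
      by apply: Tmat_congr => j sj; apply/xk/(leq_trans ks).
    have [sk|sk] := eqVneq k s; last first.
      by apply: (Tmat_single_below ipH Db Ab); rewrite ltn_neqAle val_eqE sk.
    subst s; exact: etrans (Tmat_single D Ab (v i)) (kv i).
  exists (x, fun s => projT1 (Tx s)); split=> [|s]; last exact: (projT2 (Tx s)).
  by rewrite -(single_same (v i)); exact: xk.
pose x i := (projT1 (lift_ker i)).1; pose c i := (projT1 (lift_ker i)).2.
have xk i : x i k = v i by have [] := projT2 (lift_ker i).
have Tx i s : T (x i) s = \sum_t c i s t *: w s t by have [_] := projT2 (lift_ker i).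
pose J := {s : 'I_n & 'I_(b s)}.
have cardJ : #|{: J}| = N.
  rewrite card_tagged sumnE big_map big_enum NE [RHS]big_mkcond.
  by apply: eq_bigr => s _; rewrite card_ord.
(* Row [i] lists the coefficients of [T (x i)]. There are $m>N$ rows and [N] columns, so some
   nonzero [u] satisfies $uM=0$. *)
pose M : 'M[R[i]]_(m, #|{: J}|) :=
  \matrix_(i, j) c i (tag (enum_val j)) (tagged (enum_val j)).
have /rowV0Pn[u /sub_kermxP uM u0] : kermx M != 0.
  rewrite kermx_eq0 -row_leq_rank -ltnNge (leq_ltn_trans (rank_leq_col _))//.
  by rewrite cardJ.
have comb s t : \sum_i u ord0 i * c i s t = 0.
  have := congr1 (fun B : 'rV_ _ => B ord0 (enum_rank (Tagged (fun s => 'I_(b s)) t))) uM.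
  by rewrite !mxE => h; rewrite -[RHS]h; apply: eq_bigr => i _; rewrite mxE enum_rankK.
pose z : pi := \sum_i u ord0 i *: x i.
have Tz : T z = 0.
  have TD : {morph T : y y' / y + y'} := bounded_opD (Tmat_bounded ipH Db Ab).
  have T0 : T 0 = 0 := bounded_op0 (Tmat_bounded ipH Db Ab).
  have TZ a y : T (a *: y) = a *: T y := bounded_opZ (Tmat_bounded ipH Db Ab) a y.
  rewrite /z (big_morph _ TD T0); apply/functional_extensionality_dep => s.
  rewrite pi_sumE [RHS](_ : _ = \sum_t (\sum_i u ord0 i * c i s t) *: w s t); last first.
    by rewrite big1// => t _; rewrite comb scale0r.
  under [RHS]eq_bigr do rewrite scaler_suml.
  rewrite exchange_big; apply: eq_bigr => i _ /=.
  rewrite TZ -[LHS]/(u ord0 i *: T (x i) s) Tx.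
  by rewrite scaler_sumr; apply: eq_bigr => t _; rewrite scalerA.
(* Injectivity gives $z=0$; its coordinate [k] is $\sum_i u_iv_i$, so independence of the [v i]
   kills [u]. *)
have uz : forall i, u ord0 i = 0.
  apply: indv; have := congr1 (fun y : pi => y k) (inj _ Tz); rewrite /z pi_sumE => zk.
  by rewrite /lcomb /= -[RHS]zk; apply: eq_bigr => i _; rewrite -[RHS]/(u ord0 i *: x i k) xk.
by move/eqP: u0; apply; apply/rowP => i; rewrite uz mxE.
Qed.

End TriangularKernel.

(** * Passing between $\lambda-D$ and $D-\lambda$ *)

Section ScalarShift.
Variables (R : realType) (V : lmodType R[i]) (ip : V -> V -> R[i]).
Hypothesis ipH : is_hilbert ip.
Variable l : R[i].
Local Notation nvs := (nvs_of ip).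

Lemma scal_sub_opE (T : V -> V) x : scal_sub_op (V := nvs) l T x = l *: x - T x.
Proof. exact: vsub_nvs_of. Qed.

Lemma op_sub_scalE (T : V -> V) x : op_sub_scal (V := nvs) T l x = - scal_sub_op (V := nvs) l T x.
Proof. by rewrite scal_sub_opE opprB; exact: vsub_nvs_of. Qed.

Variable T : V -> V.
Hypothesis Tb : bounded_op ip ip T.
Local Notation S := (scal_sub_op (V := nvs) l T).
Local Notation S' := (op_sub_scal (V := nvs) T l).

Lemma scal_sub_op_bounded : bounded_op ip ip S.
Proof.
split=> [a x y|].
  rewrite !scal_sub_opE (bounded_opD Tb) (bounded_opZ Tb) scalerBr !scalerDr !scalerA mulrC.
  by rewrite opprD addrACA.
have [M M0 hM] := bounded_op_bound Tb.
exists (Num.sqrt (complex.Re l ^+ 2 + complex.Im l ^+ 2) + M) => x.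
rewrite scal_sub_opE (le_trans (hnorm_le_add ipH _ _))// (hnorm_opp ipH) mulrDl.
by rewrite (hnorm_scaleC ipH) lerD2l.
Qed.

Lemma alpha_op_sub_scal : alpha (U := nvs) (W := nvs) S' = alpha (U := nvs) (W := nvs) S.
Proof.
rewrite /alpha; congr (edim _); apply/seteqP; split=> x;
  rewrite -[kernel S' x]/(S' x = 0) -[kernel S x]/(S x = 0) op_sub_scalE.
  by move=> /eqP; rewrite oppr_eq0 => /eqP.
by move=> ->; rewrite oppr0.
Qed.

Lemma beta_op_sub_scal : beta (U := nvs) (W := nvs) S' = beta (U := nvs) (W := nvs) S.
Proof.
rewrite /beta; congr (ecodim _); apply/seteqP; split=> _ [x <-]; exists (- x).
  by rewrite (bounded_opN scal_sub_op_bounded) op_sub_scalE.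
by rewrite op_sub_scalE (bounded_opN scal_sub_op_bounded) opprK.
Qed.

Lemma sigma_lP : sigma_l (V := nvs) T l <-> ~ bounded_below ip ip S.
Proof.
by split=> h bb; apply: h; apply/(left_invertibleP ipH ipH scal_sub_op_bounded).
Qed.

End ScalarShift.

(** * The left spectrum of the triangular operator *)

Section Spectrum.
Variables (R : realType) (n : nat) (X : 'I_n -> lmodType R[i]).
Variable ip : forall k, X k -> X k -> R[i].
Hypothesis ipH : forall k, is_hilbert (@ip k).
Variables (D : forall k, X k -> X k) (A : forall i j : 'I_n, X j -> X i).
Hypothesis Db : forall k, bounded_op (@ip k) (@ip k) (@D k).
Hypothesis Ab : forall i j : 'I_n, (i < j)%N -> bounded_op (@ip j) (@ip i) (@A i j).

Section Shift.
Variable l : R[i].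
Let D' k := scal_sub_op (V := nvs_of (@ip k)) l (@D k).
Let A' (i j : 'I_n) (x : X j) := - A i x.

Let D'b k : bounded_op (@ip k) (@ip k) (@D' k).
Proof. exact: scal_sub_op_bounded. Qed.

Let A'b (i j : 'I_n) : (i < j)%N -> bounded_op (@ip j) (@ip i) (@A' i j).
Proof.
move=> ij; have [M M0 hM] := bounded_op_bound (Ab ij); split=> [a x y|].
  by rewrite /A' (bounded_opD (Ab ij)) (bounded_opZ (Ab ij)) opprD scalerN.
by exists M => x; rewrite (hnorm_opp (ipH i)).
Qed.

(** The shifted operator is again triangular, with diagonal $\lambda-D_k$ and entries $-A_{ij}$, so
    the results on triangular operators apply to it. *)
Lemma scal_sub_op_Tmat :
  scal_sub_op (V := dsum ip) l (Tmat D A) = Tmat (ip := ip) D' A'.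
Proof.
apply/funext => x; apply/functional_extensionality_dep => i.
rewrite -[LHS]/(l *: x i + (-1) *: (D (x i) + \sum_(j < n | (i < j)%N) A i (x j))).
by rewrite /Tmat /D' scal_sub_opE scaleN1r opprD addrA /A' sumrN.
Qed.

Lemma sigma_l_TmatP : sigma_l (V := dsum ip) (Tmat D A) l <->
  ~ bounded_below (pi_ip ip) (pi_ip ip) (Tmat (ip := ip) D' A').
Proof.
rewrite /sigma_l /mkset scal_sub_op_Tmat; apply/iff_not2.
exact: iff_trans (dsum_left_invertible ipH _)
  (left_invertibleP (pi_hilbert ipH) (pi_hilbert ipH) (Tmat_bounded ipH D'b A'b)).
Qed.

(** If $\lambda-T$ is bounded below, restriction to the first summand excludes the first index; for
    a later index, injectivity gives the dimension inequality that places $\lambda$ in [Delta]. *)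
Lemma sigma_l_diagonal_subset k : sigma_l (V := nvs_of (@ip k)) (@D k) l ->
  (sigma_l (V := dsum ip) (Tmat D A) `|` Delta ip D) l.
Proof.
move=> Dk; apply: contrapT => /not_orP[/sigma_l_TmatP/contrapT Tbb nDelta].
have := Dk; move/(sigma_lP (ipH k) _ (Db k)); apply.
have [k0|k0] := posnP k; first exact: (Tmat_bounded_below_first ipH D'b A'b k0).
exfalso; apply: nDelta; exists k; split=> //; split=> //.
rewrite (alpha_op_sub_scal (@ip k)).
under eq_bigr do rewrite (beta_op_sub_scal (ipH _) _ (Db _)).
apply: (injective_Tmat_alpha_le ipH D'b A'b).
exact: (bounded_below_inj (pi_hilbert ipH) (pi_hilbert ipH) Tbb).
Qed.

Lemma sigma_l_Tmat_subset : sigma_l (V := dsum ip) (Tmat D A) l ->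
  exists k, sigma_l (V := nvs_of (@ip k)) (@D k) l.
Proof.
move=> /sigma_l_TmatP nbb; apply: contrapT => /forallNP h; apply: nbb.
apply: (Tmat_bounded_below ipH A'b) => k.
by apply: contrapT => /(sigma_lP (ipH k) _ (Db k)); exact: h.
Qed.

End Shift.

Lemma sigma_l_Tmat_Delta :
  [set l | exists k, sigma_l (V := nvs_of (@ip k)) (@D k) l] =
  sigma_l (V := dsum ip) (Tmat D A) `|` Delta ip D.
Proof.
apply/seteqP; split=> l; first by move=> [k]; exact: sigma_l_diagonal_subset.
by move=> [/sigma_l_Tmat_subset//|[k [_ [Dk _]]]]; exists k.
Qed.

End Spectrum.

Theorem mainTheorem13 (R : realType) (n : nat) (X : 'I_n -> lmodType R[i])
  (ip : forall k, X k -> X k -> R[i]) (D : forall k, X k -> X k) :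
  (2 <= n)%N ->
  (forall k, is_hilbert (ip k)) ->
  (forall k, infinite_dim (ip k)) ->
  (forall k, bounded_op (ip k) (ip k) (D k)) ->
  (forall A : forall i j : 'I_n, X j -> X i,
     (forall i j : 'I_n, (i < j)%N -> bounded_op (ip j) (ip i) (A i j)) ->
     [set l | exists k : 'I_n, sigma_l (V := nvs_of (ip k)) (D k) l]
       = sigma_l (V := dsum ip) (Tmat D A) `|` Delta ip D)
  /\
  (Delta ip D = set0 ->
   forall A : forall i j : 'I_n, X j -> X i,
     (forall i j : 'I_n, (i < j)%N -> bounded_op (ip j) (ip i) (A i j)) ->
     [set l | exists k : 'I_n, sigma_l (V := nvs_of (ip k)) (D k) l]
       = sigma_l (V := dsum ip) (Tmat D A)).
Proof.
move=> _ ipH _ Db; split=> [A Ab|D0 A Ab]; first exact: sigma_l_Tmat_Delta.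
by rewrite (sigma_l_Tmat_Delta ipH Db Ab) D0 setU0.
Qed.
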